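(* Let $\mathbf{L}$ be one of the logics described in the context (determined by a set $N$ of non-logical rules). If a labelled sequent $\Gamma\Rightarrow\Delta$ is $\mathbf{G3Q\lambda.L}$-derivable, then it is $\mathbf{Q\lambda.L}$-valid.
   Context: Language $\mathcal{L}^\lambda$: fix a signature of $n$-ary predicate letters and an infinite set of variables $x,y,z,\dots$. Terms and formulas are defined simultaneously: terms $t::=x\mid \iota xA$ (definite descriptions, ''the $x$ such that $A$''), formulas $A::=Px_1\dots x_n\mid x_1=x_2\mid\bot\mid A\wedge A\mid A\vee A\mid A\supset A\mid\forall xA\mid\exists xA\mid\Box A\mid\Diamond A\mid \lambda xA.t$. Thus descriptions occur in formulas only as the term of a $\lambda$-abstract. $\iota x$ binds $x$ in $A$; in $\lambda xA.t$ the occurrences of $x$ in $A$ are bound by $\lambda x$ (the displayed $t$ is not in its scope). $A[y/x]$ is the result of replacing the free occurrences of $x$ by $y$, with $y$ free for $x$. Atomic formulas are $Px_1\dots x_n$ and $x_1=x_2$. Semantics. A model is $\mathcal{M}=\langle\mathcal{W},\mathcal{R},\mathcal{D},\mathcal{V}\rangle$: $\mathcal{W}\neq\varnothing$ a set of worlds, $\mathcal{R}\subseteq\mathcal{W}\times\mathcal{W}$, $\mathcal{D}$ assigns to each $w$ a possibly empty set $D_w$ with $D_\mathcal{W}=\bigcup_w D_w$ nonempty and disjoint from $\mathcal{W}$, and $\mathcal{V}(P,w)\subseteq (D_\mathcal{W})^n$ for each $n$-ary $P$. An assignment $\sigma$ maps variables into $D_\mathcal{W}$; $\sigma^{x\triangleright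 o}$ is $\sigma$ with $x$ sent to $o$. Denotation: $\mathcal{V}^\sigma_w(x)=\sigma(x)$; $\mathcal{V}^\sigma_w(\iota xA)=o$ iff $o$ is the one and only member of $D_\mathcal{W}$ with $\sigma^{x\triangleright o}\models_w A$ (undefined otherwise). Satisfaction: $\sigma\models_w Px_1\dots x_n$ iff $\langle\sigma(x_1),\dots,\sigma(x_n)\rangle\in\mathcal{V}(P,w)$; $\sigma\models_w x=y$ iff $\sigma(x)=\sigma(y)$; $\bot$ never; Boolean connectives classical; $\sigma\models_w\forall xB$ iff $\sigma^{x\triangleright o}\models_w B$ for all $o\in D_w$; $\sigma\models_w\exists xB$ iff for some $o\in D_w$; $\sigma\models_w\Box B$ iff $\sigma\models_v B$ for all $v$ with $w\mathcal{R}v$; $\sigma\models_w\Diamond B$ iff for some such $v$; $\sigma\models_w\lambda xA.t$ iff $\mathcal{V}^\sigma_w(t)$ is defined and $\sigma^{x\triangleright\mathcal{V}^\sigma_w(t)}\models_w A$. Labelled sequents. Labels $w,v,u,\dots$ form a separate set. Expressions: labelled formulas $w:A$ ($A\in\mathcal{L}^\lambda$), domain atoms $x\in w$, relational atoms $w\mathscr{R}v$, denotation formulas $D(t,x,w)$ ($t$ a term, $x$ a variable). A sequent $\Gamma\Rightarrow\Delta$ has $\Gamma$ a multiset of labelled formulas, denotation formulas, domain atoms and relational atoms, and $\Delta$ a multiset of labelled formulas and denotation formulas. Substitutions $[y/x]$, $[w/v]$ extend componentwise. ''Fresh'' means not occurring in the conclusion of the rule. Calculus $\mathbf{G3Q\lambda.K}$.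 Initial sequents: $w:p,\Gamma\Rightarrow\Delta,w:p$ ($p$ atomic); $D(y,x,w),\Gamma\Rightarrow\Delta,D(y,x,w)$ ($y$ a variable); $w:\bot,\Gamma\Rightarrow\Delta$. Propositional rules (all at one label $w$): $L\wedge$: from $w:A,w:B,\Gamma\Rightarrow\Delta$ infer $w:A\wedge B,\Gamma\Rightarrow\Delta$; $R\wedge$: from $\Gamma\Rightarrow\Delta,w:A$ and $\Gamma\Rightarrow\Delta,w:B$ infer $\Gamma\Rightarrow\Delta,w:A\wedge B$; $L\vee$: from $w:A,\Gamma\Rightarrow\Delta$ and $w:B,\Gamma\Rightarrow\Delta$ infer $w:A\vee B,\Gamma\Rightarrow\Delta$; $R\vee$: from $\Gamma\Rightarrow\Delta,w:A,w:B$ infer $\Gamma\Rightarrow\Delta,w:A\vee B$; $L\supset$: from $\Gamma\Rightarrow\Delta,w:A$ and $w:B,\Gamma\Rightarrow\Delta$ infer $w:A\supset B,\Gamma\Rightarrow\Delta$; $R\supset$: from $w:A,\Gamma\Rightarrow\Delta,w:B$ infer $\Gamma\Rightarrow\Delta,w:A\supset B$. Quantifiers: $L\forall$: from $w:A[y/x],y\in w,w:\forall xA,\Gamma\Rightarrow\Delta$ infer $y\in w,w:\forall xA,\Gamma\Rightarrow\Delta$; $R\forall$ ($z$ fresh): from $z\in w,\Gamma\Rightarrow\Delta,w:A[z/x]$ infer $\Gamma\Rightarrow\Delta,w:\forall xA$; $L\exists$ ($z$ fresh): from $z\in w,w:A[z/x],\Gamma\Rightarrow\Delta$ infer $w:\exists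 xA,\Gamma\Rightarrow\Delta$; $R\exists$: from $y\in w,\Gamma\Rightarrow\Delta,w:\exists xA,w:A[y/x]$ infer $y\in w,\Gamma\Rightarrow\Delta,w:\exists xA$. Modalities: $L\Box$: from $v:A,w\mathscr{R}v,w:\Box A,\Gamma\Rightarrow\Delta$ infer $w\mathscr{R}v,w:\Box A,\Gamma\Rightarrow\Delta$; $R\Box$ ($u$ fresh): from $w\mathscr{R}u,\Gamma\Rightarrow\Delta,u:A$ infer $\Gamma\Rightarrow\Delta,w:\Box A$; $L\Diamond$ ($u$ fresh): from $w\mathscr{R}u,u:A,\Gamma\Rightarrow\Delta$ infer $w:\Diamond A,\Gamma\Rightarrow\Delta$; $R\Diamond$: from $w\mathscr{R}v,\Gamma\Rightarrow\Delta,w:\Diamond A,v:A$ infer $w\mathscr{R}v,\Gamma\Rightarrow\Delta,w:\Diamond A$. Identity: $Ref_=$: from $w:x=x,\Gamma\Rightarrow\Delta$ infer $\Gamma\Rightarrow\Delta$; $RigVar$: from $v:y=z,w:y=z,\Gamma\Rightarrow\Delta$ infer $w:y=z,\Gamma\Rightarrow\Delta$; $Repl$: from $E[z/x],E[y/x],w:y=z,\Gamma\Rightarrow\Delta$ infer $E[y/x],w:y=z,\Gamma\Rightarrow\Delta$, where $E$ is a denotation formula with variable first argument and label $w$, a domain atom $x'\in w$, or a labelled atomic formula $w:p$. $\lambda$: $L\lambda$ ($z$ fresh): from $D(t,z,w),w:B[z/x],\Gamma\Rightarrow\Delta$ infer $w:\lambda xB.t,\Gamma\Rightarrow\Delta$;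 $R\lambda$: from $\Gamma\Rightarrow\Delta,w:\lambda xB.t,D(t,y,w)$ and $\Gamma\Rightarrow\Delta,w:\lambda xB.t,w:B[y/x]$ infer $\Gamma\Rightarrow\Delta,w:\lambda xB.t$. Denotation: $LD_1$: from $w:A[x_2/x_1],D(\iota x_1A,x_2,w),\Gamma\Rightarrow\Delta$ infer $D(\iota x_1A,x_2,w),\Gamma\Rightarrow\Delta$; $LD_2$: from $D(\iota x_1A,x_2,w),\Gamma\Rightarrow\Delta,w:A[y/x_1]$ and $w:x_2=y,D(\iota x_1A,x_2,w),\Gamma\Rightarrow\Delta$ infer $D(\iota x_1A,x_2,w),\Gamma\Rightarrow\Delta$; $RD$ ($z$ fresh): from $\Gamma\Rightarrow\Delta,w:A[x_2/x_1]$ and $w:A[z/x_1],\Gamma\Rightarrow\Delta,w:x_2=z$ infer $\Gamma\Rightarrow\Delta,D(\iota x_1A,x_2,w)$; $DenVar$: from $D(x,x,w),\Gamma\Rightarrow\Delta$ infer $\Gamma\Rightarrow\Delta$; $DenId$: from $w:y=x,D(y,x,w),\Gamma\Rightarrow\Delta$ infer $D(y,x,w),\Gamma\Rightarrow\Delta$ ($x,y$ variables). Non-logical rules: $Ref_\mathcal{W}$: from $w\mathscr{R}w,\Gamma\Rightarrow\Delta$ infer $\Gamma\Rightarrow\Delta$ (reflexivity); $Ser$ ($u$ fresh): from $w\mathscr{R}u,\Gamma\Rightarrow\Delta$ infer $\Gamma\Rightarrow\Delta$ (seriality); $Trans$: from $w\mathscr{R}u,w\mathscr{R}v,v\mathscr{R}u,\Gamma\Rightarrow\Delta$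 infer $w\mathscr{R}v,v\mathscr{R}u,\Gamma\Rightarrow\Delta$ (transitivity); $Eucl$: from $v\mathscr{R}u,w\mathscr{R}v,w\mathscr{R}u,\Gamma\Rightarrow\Delta$ infer $w\mathscr{R}v,w\mathscr{R}u,\Gamma\Rightarrow\Delta$, always together with $Eucl^c$: from $v\mathscr{R}v,w\mathscr{R}v,\Gamma\Rightarrow\Delta$ infer $w\mathscr{R}v,\Gamma\Rightarrow\Delta$ (Euclideanness); $Incr$: from $x\in v,x\in w,w\mathscr{R}v,\Gamma\Rightarrow\Delta$ infer $x\in w,w\mathscr{R}v,\Gamma\Rightarrow\Delta$ (increasing domains: $w\mathcal{R}v\Rightarrow D_w\subseteq D_v$); $Decr$: from $x\in w,x\in v,w\mathscr{R}v,\Gamma\Rightarrow\Delta$ infer $x\in v,w\mathscr{R}v,\Gamma\Rightarrow\Delta$ (decreasing domains); $Cons$: from $x\in w,\Gamma\Rightarrow\Delta$ infer $\Gamma\Rightarrow\Delta$ (constant domains: $w\mathcal{R}v\Rightarrow D_w=D_v$). For a set $N$ of these non-logical rules, $\mathbf{G3Q\lambda.L}=\mathbf{G3Q\lambda.K}+N$, and $\mathbf{Q\lambda.L}$ is the logic of the class of frames $\langle\mathcal{W},\mathcal{R},\mathcal{D}\rangle$ satisfying the corresponding properties; a model for $\mathbf{Q\lambda.L}$ is one based on such a frame. Derivations: trees of sequents with initial sequents at the leaves, built by the rules, of pure sequents (no variable both free and bound). $\Gamma\Rightarrow\Delta$ is derivable if it or an alphabetic variant has a derivation. Validity: for a model $\mathcal{M}$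 and $f$ mapping labels to worlds and variables to $D_\mathcal{W}$: $\mathcal{M}$ satisfies $w:A$ under $f$ iff $f\models_{f(w)}A$; $x\in w$ iff $f(x)\in D_{f(w)}$; $w\mathscr{R}v$ iff $f(w)\mathcal{R}f(v)$; $D(t,x,w)$ iff $f(t)=f(x)$ when $t$ is a variable, and, when $t\equiv\iota yA$, iff for all $o\in D_\mathcal{W}$: $f^{y\triangleright o}\models_{f(w)}A$ iff $o=f(x)$. $\Gamma\Rightarrow\Delta$ is $\mathbf{Q\lambda.L}$-valid iff for every model $\mathcal{M}$ for $\mathbf{Q\lambda.L}$ and every $f$, if $\mathcal{M}$ satisfies all of $\Gamma$ under $f$ then it satisfies some member of $\Delta$ under $f$.
   Formalization: For N containing Cons, constant domains is taken as D_w = D_v for all worlds w, v, not only when wRv: with the latter, Cons is unsound (it derives w:∃x(x=x), which fails at a world with empty domain and no access to other worlds). *)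

(* Defs.v *)
From mathcomp Require Import all_boot.
From Stdlib Require List Permutation.

Set Implicit Arguments.
Unset Strict Implicit.
Unset Printing Implicit Defensive.

Record language := Language {
  letter : Type;
  arity : letter -> nat;
  var : eqType;
  var_infinite : forall s : seq var, exists x, x \notin s
}.

(* [Lam x A t] is the formula written  lambda x A . t;  [t] is outside the
   scope of [x]. *)
Inductive term (L : language) : Type :=
| Var of var L
| Iota of var L & formula L
with formula (L : language) : Type :=
| Atom (P : letter L) of (arity P).-tuple (var L)
| Eq of var L & var L
| Bot
| And of formula L & formula L
| Or of formula L & formula L
| Imp of formula L & formula L
| All of var L & formula L
| Ex of var L & formula L
| Box of formula L
| Dia of formula L
| Lam of var L & formula L & term L.

Arguments Bot {L}.

Definition atomic (L : language) (A : formula L) : bool :=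
  match A with Atom _ _ | Eq _ _ => true | _ => false end.

Fixpoint tfv (L : language) (t : term L) : seq (var L) :=
  match t with
  | Var x => [:: x]
  | Iota x A => [seq y <- fv A | y != x]
  end
with fv (L : language) (A : formula L) : seq (var L) :=
  match A with
  | Atom _ xs => xs
  | Eq x y => [:: x; y]
  | Bot => [::]
  | And B C | Or B C | Imp B C => fv B ++ fv C
  | All x B | Ex x B => [seq y <- fv B | y != x]
  | Box B | Dia B => fv B
  | Lam x B t => [seq y <- fv B | y != x] ++ tfv t
  end.

(* The variable next to a binder counts as a bound occurrence, even when the
   binder is vacuous. *)
Fixpoint tbv (L : language) (t : term L) : seq (var L) :=
  match t with
  | Var _ => [::]
  | Iota x A => x :: bv A
  end
with bv (L : language) (A : formula L) : seq (var L) :=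
  match A with
  | Atom _ _ | Eq _ _ | Bot => [::]
  | And B C | Or B C | Imp B C => bv B ++ bv C
  | All x B | Ex x B => x :: bv B
  | Box B | Dia B => bv B
  | Lam x B t => x :: bv B ++ tbv t
  end.

Definition vsubst (L : language) (y x z : var L) : var L :=
  if z == x then y else z.

(* [subst y x A] is A[y/x].  It does not rename bound variables: it is the
   intended substitution only when [free_for y x A] holds. *)
Fixpoint tsubst (L : language) (y x : var L) (t : term L) : term L :=
  match t with
  | Var z => Var (vsubst y x z)
  | Iota z A => Iota z (if z == x then A else subst y x A)
  end
with subst (L : language) (y x : var L) (A : formula L) : formula L :=
  match A with
  | Atom P zs => @Atom L P (map_tuple (vsubst y x) zs)
  | Eq z1 z2 => Eq (vsubst y x z1) (vsubst y x z2)
  | Bot => Bot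
  | And B C => And (subst y x B) (subst y x C)
  | Or B C => Or (subst y x B) (subst y x C)
  | Imp B C => Imp (subst y x B) (subst y x C)
  | All z B => All z (if z == x then B else subst y x B)
  | Ex z B => Ex z (if z == x then B else subst y x B)
  | Box B => Box (subst y x B)
  | Dia B => Dia (subst y x B)
  | Lam z B t => Lam z (if z == x then B else subst y x B) (tsubst y x t)
  end.

(* [y] is free for [x]: no free occurrence of [x] lies in the scope of a
   binder of [y]. *)
Fixpoint tfree_for (L : language) (y x : var L) (t : term L) : bool :=
  match t with
  | Var _ => true
  | Iota z A => [|| z == x, x \notin fv A | (z != y) && free_for y x A]
  end
with free_for (L : language) (y x : var L) (A : formula L) : bool :=
  match A with
  | Atom _ _ | Eq _ _ | Bot => true
  | And B C | Or B C | Imp B C => free_for y x B && free_for y x C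
  | All z B | Ex z B => [|| z == x, x \notin fv B | (z != y) && free_for y x B]
  | Box B | Dia B => free_for y x B
  | Lam z B t =>
      [|| z == x, x \notin fv B | (z != y) && free_for y x B]
      && tfree_for y x t
  end.

(* Alphabetic variance.  The list [r] records the pairs of variables bound at
   the same places on both sides, innermost first; variables bound on neither
   side must be equal. *)
Fixpoint alpha_var (L : language) (r : seq (var L * var L)) (x y : var L) :
    bool :=
  match r with
  | [::] => x == y
  | (a, b) :: r' =>
      if (x == a) || (y == b) then (x == a) && (y == b) else alpha_var r' x y
  end.

Inductive alpha_term (L : language) :
    seq (var L * var L) -> term L -> term L -> Prop :=
| alpha_Var r x y : alpha_var r x y -> alpha_term r (Var x) (Var y)
| alpha_Iota r x y A B :
    alpha_form ((x, y) :: r) A B -> alpha_term r (Iota x A) (Iota y B)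
with alpha_form (L : language) :
    seq (var L * var L) -> formula L -> formula L -> Prop :=
| alpha_Atom r P (xs ys : (arity P).-tuple (var L)) :
    (forall i, alpha_var r (tnth xs i) (tnth ys i)) ->
    alpha_form r (Atom xs) (Atom ys)
| alpha_Eq r x1 x2 y1 y2 :
    alpha_var r x1 y1 -> alpha_var r x2 y2 ->
    alpha_form r (Eq x1 x2) (Eq y1 y2)
| alpha_Bot r : alpha_form r Bot Bot
| alpha_And r A1 A2 B1 B2 :
    alpha_form r A1 B1 -> alpha_form r A2 B2 ->
    alpha_form r (And A1 A2) (And B1 B2)
| alpha_Or r A1 A2 B1 B2 :
    alpha_form r A1 B1 -> alpha_form r A2 B2 ->
    alpha_form r (Or A1 A2) (Or B1 B2)
| alpha_Imp r A1 A2 B1 B2 :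
    alpha_form r A1 B1 -> alpha_form r A2 B2 ->
    alpha_form r (Imp A1 A2) (Imp B1 B2)
| alpha_All r x y A B :
    alpha_form ((x, y) :: r) A B -> alpha_form r (All x A) (All y B)
| alpha_Ex r x y A B :
    alpha_form ((x, y) :: r) A B -> alpha_form r (Ex x A) (Ex y B)
| alpha_Box r A B : alpha_form r A B -> alpha_form r (Box A) (Box B)
| alpha_Dia r A B : alpha_form r A B -> alpha_form r (Dia A) (Dia B)
| alpha_Lam r x y A B t s :
    alpha_form ((x, y) :: r) A B -> alpha_term r t s ->
    alpha_form r (Lam x A t) (Lam y B s).

(* The type [obj] is D_W, the union of the domains, whence [dom_cover].
   Worlds and objects are disjoint because they have different types. *)
Record frame := Frame {
  world : Type;
  acc : world -> world -> Prop;
  obj : Type;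
  dom : world -> obj -> Prop;
  world_inh : inhabited world;
  obj_inh : inhabited obj;
  dom_cover : forall o : obj, exists w : world, dom w o
}.

Record model (L : language) := Model {
  model_frame :> frame;
  interp : forall P : letter L,
    world model_frame -> (arity P).-tuple (obj model_frame) -> Prop
}.

Definition upd (L : language) (O : Type) (f : var L -> O) (x : var L) (o : O) :
    var L -> O :=
  fun y => if y == x then o else f y.

(* Denotation is a partial function, given by its graph: [den f w t o] says
   that the denotation of [t] at [w] under [f] is defined and equal to [o]. *)
Fixpoint den (L : language) (M : model L) (f : var L -> obj M) (w : world M)
    (t : term L) (o : obj M) : Prop :=
  match t with
  | Var x => o = f x
  | Iota x A => unique (fun o' => sat (upd f x o') w A) o
  end
with sat (L : language) (M : model L) (f : var L -> obj M) (w : world M)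
    (A : formula L) : Prop :=
  match A with
  | Atom P xs => interp (m := M) (P := P) w (map_tuple f xs)
  | Eq x y => f x = f y
  | Bot => False
  | And B C => sat f w B /\ sat f w C
  | Or B C => sat f w B \/ sat f w C
  | Imp B C => sat f w B -> sat f w C
  | All x B => forall o, dom w o -> sat (upd f x o) w B
  | Ex x B => exists2 o, dom w o & sat (upd f x o) w B
  | Box B => forall v, acc w v -> sat f v B
  | Dia B => exists2 v, acc w v & sat f v B
  | Lam x B t => exists2 o, den f w t o & sat (upd f x o) w B
  end.

(* Expressions allowed on both sides of a sequent: w : A  and  D(t, x, w). *)
Inductive sexpr (L : language) (label : eqType) : Type :=
| LF of label & formula L
| Den of term L & var L & label.

(* Expressions allowed in the antecedent: the former, x \in w  and  w R v. *)
Inductive aexpr (L : language) (label : eqType) : Type :=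
| Sx of sexpr L label
| Dom of var L & label
| Rel of label & label.

Arguments LF {L label}.
Arguments Den {L label}.
Arguments Sx {L label}.
Arguments Dom {L label}.
Arguments Rel {L label}.

Coercion Sx : sexpr >-> aexpr.

(* Antecedent and succedent are multisets, represented by lists that
   [derivation] below uses only up to permutation. *)
Record sequent (L : language) (label : eqType) := Sequent {
  ant : seq (aexpr L label);
  suc : seq (sexpr L label)
}.

Notation "G ⇒ D" := (Sequent G D) (at level 90, no associativity).

Definition sx_fv (L : language) (label : eqType) (e : sexpr L label) :
    seq (var L) :=
  match e with LF _ A => fv A | Den t x _ => x :: tfv t end.

Definition sx_bv (L : language) (label : eqType) (e : sexpr L label) :
    seq (var L) :=
  match e with LF _ A => bv A | Den t _ _ => tbv t end.

Definition sx_labels (L : language) (label : eqType) (e : sexpr L label) :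
    seq label :=
  match e with LF w _ | Den _ _ w => [:: w] end.

Definition ax_fv (L : language) (label : eqType) (e : aexpr L label) :
    seq (var L) :=
  match e with Sx e' => sx_fv e' | Dom x _ => [:: x] | Rel _ _ => [::] end.

Definition ax_bv (L : language) (label : eqType) (e : aexpr L label) :
    seq (var L) :=
  match e with Sx e' => sx_bv e' | _ => [::] end.

Definition ax_labels (L : language) (label : eqType) (e : aexpr L label) :
    seq label :=
  match e with Sx e' => sx_labels e' | Dom _ w => [:: w] | Rel w v => [:: w; v] end.

Definition seq_fv (L : language) (label : eqType) (S : sequent L label) :
    seq (var L) :=
  flatten (map (@ax_fv L label) (ant S)) ++
  flatten (map (@sx_fv L label) (suc S)).

Definition seq_bv (L : language) (label : eqType) (S : sequent L label) :
    seq (var L) :=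
  flatten (map (@ax_bv L label) (ant S)) ++
  flatten (map (@sx_bv L label) (suc S)).

Definition seq_labels (L : language) (label : eqType) (S : sequent L label) :
    seq label :=
  flatten (map (@ax_labels L label) (ant S)) ++
  flatten (map (@sx_labels L label) (suc S)).

Definition pure (L : language) (label : eqType) (S : sequent L label) : Prop :=
  forall x, x \in seq_fv S -> x \notin seq_bv S.

Definition fresh_var (L : language) (label : eqType) (z : var L)
    (S : sequent L label) : bool :=
  (z \notin seq_fv S) && (z \notin seq_bv S).

Definition fresh_label (L : language) (label : eqType) (u : label)
    (S : sequent L label) : bool :=
  u \notin seq_labels S.

Definition seq_perm (L : language) (label : eqType) (S S' : sequent L label) :
    Prop :=
  Permutation.Permutation (ant S) (ant S') /\
  Permutation.Permutation (suc S) (suc S').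

Definition sx_subst (L : language) (label : eqType) (y x : var L)
    (e : sexpr L label) : sexpr L label :=
  match e with
  | LF w A => LF w (subst y x A)
  | Den t z w => Den (tsubst y x t) (vsubst y x z) w
  end.

Definition ax_subst (L : language) (label : eqType) (y x : var L)
    (e : aexpr L label) : aexpr L label :=
  match e with
  | Sx e' => Sx (sx_subst y x e')
  | Dom z w => Dom (vsubst y x z) w
  | Rel w v => Rel w v
  end.

Inductive alpha_sx (L : language) (label : eqType) :
    sexpr L label -> sexpr L label -> Prop :=
| alpha_LF w A B : alpha_form [::] A B -> alpha_sx (LF w A) (LF w B)
| alpha_Den t s x w : alpha_term [::] t s -> alpha_sx (Den t x w) (Den s x w).

Inductive alpha_ax (L : language) (label : eqType) :
    aexpr L label -> aexpr L label -> Prop :=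
| alpha_Sx e e' : alpha_sx e e' -> alpha_ax (Sx e) (Sx e')
| alpha_Dom x w : alpha_ax (Dom x w) (Dom x w)
| alpha_Rel w v : alpha_ax (Rel w v) (Rel w v).

Definition alpha_sequent (L : language) (label : eqType)
    (S S' : sequent L label) : Prop :=
  List.Forall2 (@alpha_ax L label) (ant S) (ant S') /\
  List.Forall2 (@alpha_sx L label) (suc S) (suc S').

(* [NEucl] stands for the rule Eucl together with its contracted form. *)
Inductive nlrule :=
| NRef | NSer | NTrans | NEucl | NIncr | NDecr | NCons.

(* The expressions that the rule Repl may rewrite at the label [w]. *)
Inductive repl_expr (L : language) (label : eqType) (w : label) :
    aexpr L label -> Prop :=
| repl_Den x1 x2 : repl_expr w (Den (Var x1) x2 w)
| repl_Dom x : repl_expr w (Dom x w)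
| repl_LF p : atomic p -> repl_expr w (LF w p).

(* [rule N ps S]: the sequent [S] follows from the premises [ps] by one rule of
   G3Qlambda.K + N; initial sequents are the rules without premises. *)
Inductive rule (L : language) (label : eqType) (N : nlrule -> Prop) :
    seq (sequent L label) -> sequent L label -> Prop :=
| Init_atomic w p G D : atomic p ->
    rule N [::] (Sx (LF w p) :: G ⇒ LF w p :: D)
| Init_den y x w G D :
    rule N [::] (Sx (Den (Var y) x w) :: G ⇒ Den (Var y) x w :: D)
| Init_bot w G D :
    rule N [::] (Sx (LF w Bot) :: G ⇒ D)

| L_and w A B G D :
    rule N [:: Sx (LF w A) :: Sx (LF w B) :: G ⇒ D]
      (Sx (LF w (And A B)) :: G ⇒ D)
| R_and w A B G D :
    rule N [:: G ⇒ LF w A :: D; G ⇒ LF w B :: D]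
      (G ⇒ LF w (And A B) :: D)
| L_or w A B G D :
    rule N [:: Sx (LF w A) :: G ⇒ D; Sx (LF w B) :: G ⇒ D]
      (Sx (LF w (Or A B)) :: G ⇒ D)
| R_or w A B G D :
    rule N [:: G ⇒ LF w A :: LF w B :: D]
      (G ⇒ LF w (Or A B) :: D)
| L_imp w A B G D :
    rule N [:: G ⇒ LF w A :: D; Sx (LF w B) :: G ⇒ D]
      (Sx (LF w (Imp A B)) :: G ⇒ D)
| R_imp w A B G D :
    rule N [:: Sx (LF w A) :: G ⇒ LF w B :: D]
      (G ⇒ LF w (Imp A B) :: D)

| L_all w x y A G D : free_for y x A ->
    rule N [:: Sx (LF w (subst y x A)) :: Dom y w :: Sx (LF w (All x A)) :: G
                 ⇒ D]
      (Dom y w :: Sx (LF w (All x A)) :: G ⇒ D)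
| R_all w x z A G D : fresh_var z (G ⇒ LF w (All x A) :: D) ->
    rule N [:: Dom z w :: G ⇒ LF w (subst z x A) :: D]
      (G ⇒ LF w (All x A) :: D)
| L_ex w x z A G D : fresh_var z (Sx (LF w (Ex x A)) :: G ⇒ D) ->
    rule N [:: Dom z w :: Sx (LF w (subst z x A)) :: G ⇒ D]
      (Sx (LF w (Ex x A)) :: G ⇒ D)
| R_ex w x y A G D : free_for y x A ->
    rule N [:: Dom y w :: G ⇒ LF w (Ex x A) :: LF w (subst y x A) :: D]
      (Dom y w :: G ⇒ LF w (Ex x A) :: D)

| L_box w v A G D :
    rule N [:: Sx (LF v A) :: Rel w v :: Sx (LF w (Box A)) :: G ⇒ D]
      (Rel w v :: Sx (LF w (Box A)) :: G ⇒ D)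
| R_box w u A G D : fresh_label u (G ⇒ LF w (Box A) :: D) ->
    rule N [:: Rel w u :: G ⇒ LF u A :: D]
      (G ⇒ LF w (Box A) :: D)
| L_dia w u A G D : fresh_label u (Sx (LF w (Dia A)) :: G ⇒ D) ->
    rule N [:: Rel w u :: Sx (LF u A) :: G ⇒ D]
      (Sx (LF w (Dia A)) :: G ⇒ D)
| R_dia w v A G D :
    rule N [:: Rel w v :: G ⇒ LF w (Dia A) :: LF v A :: D]
      (Rel w v :: G ⇒ LF w (Dia A) :: D)

| Ref_eq w x G D :
    rule N [:: Sx (LF w (Eq x x)) :: G ⇒ D] (G ⇒ D)
| RigVar v w y z G D :
    rule N [:: Sx (LF v (Eq y z)) :: Sx (LF w (Eq y z)) :: G ⇒ D]
      (Sx (LF w (Eq y z)) :: G ⇒ D)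
| Repl w x y z E G D : repl_expr w E ->
    rule N [:: ax_subst z x E :: ax_subst y x E :: Sx (LF w (Eq y z)) :: G ⇒ D]
      (ax_subst y x E :: Sx (LF w (Eq y z)) :: G ⇒ D)

| L_lam w x z B t G D : fresh_var z (Sx (LF w (Lam x B t)) :: G ⇒ D) ->
    rule N [:: Sx (Den t z w) :: Sx (LF w (subst z x B)) :: G ⇒ D]
      (Sx (LF w (Lam x B t)) :: G ⇒ D)
| R_lam w x y B t G D : free_for y x B ->
    rule N [:: G ⇒ LF w (Lam x B t) :: Den t y w :: D;
               G ⇒ LF w (Lam x B t) :: LF w (subst y x B) :: D]
      (G ⇒ LF w (Lam x B t) :: D)

| L_den1 w x1 x2 A G D : free_for x2 x1 A ->
    rule N [:: Sx (LF w (subst x2 x1 A)) :: Sx (Den (Iota x1 A) x2 w) :: G ⇒ D]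
      (Sx (Den (Iota x1 A) x2 w) :: G ⇒ D)
| L_den2 w x1 x2 y A G D : free_for y x1 A ->
    rule N [:: Sx (Den (Iota x1 A) x2 w) :: G ⇒ LF w (subst y x1 A) :: D;
               Sx (LF w (Eq x2 y)) :: Sx (Den (Iota x1 A) x2 w) :: G ⇒ D]
      (Sx (Den (Iota x1 A) x2 w) :: G ⇒ D)
| R_den w x1 x2 z A G D :
    free_for x2 x1 A -> fresh_var z (G ⇒ Den (Iota x1 A) x2 w :: D) ->
    rule N [:: G ⇒ LF w (subst x2 x1 A) :: D;
               Sx (LF w (subst z x1 A)) :: G ⇒ LF w (Eq x2 z) :: D]
      (G ⇒ Den (Iota x1 A) x2 w :: D)
| DenVar w x G D :
    rule N [:: Sx (Den (Var x) x w) :: G ⇒ D] (G ⇒ D)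
| DenId w x y G D :
    rule N [:: Sx (LF w (Eq y x)) :: Sx (Den (Var y) x w) :: G ⇒ D]
      (Sx (Den (Var y) x w) :: G ⇒ D)

| Ref_W w G D : N NRef ->
    rule N [:: Rel w w :: G ⇒ D] (G ⇒ D)
| Ser w u G D : N NSer -> fresh_label u (G ⇒ D) ->
    rule N [:: Rel w u :: G ⇒ D] (G ⇒ D)
| Trans w v u G D : N NTrans ->
    rule N [:: Rel w u :: Rel w v :: Rel v u :: G ⇒ D]
      (Rel w v :: Rel v u :: G ⇒ D)
| Eucl w v u G D : N NEucl ->
    rule N [:: Rel v u :: Rel w v :: Rel w u :: G ⇒ D]
      (Rel w v :: Rel w u :: G ⇒ D)
| Eucl_c w v G D : N NEucl ->
    rule N [:: Rel v v :: Rel w v :: G ⇒ D]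
      (Rel w v :: G ⇒ D)
| Incr w v x G D : N NIncr ->
    rule N [:: Dom x v :: Dom x w :: Rel w v :: G ⇒ D]
      (Dom x w :: Rel w v :: G ⇒ D)
| Decr w v x G D : N NDecr ->
    rule N [:: Dom x w :: Dom x v :: Rel w v :: G ⇒ D]
      (Dom x v :: Rel w v :: G ⇒ D)
| ConsDom w x G D : N NCons ->
    rule N [:: Dom x w :: G ⇒ D] (G ⇒ D).

(* Every sequent of a derivation is pure; [S'] lists the multisets of [S] with
   the principal expressions in front. *)
Inductive derivation (L : language) (label : eqType) (N : nlrule -> Prop) :
    sequent L label -> Prop :=
| derive S S' ps :
    pure S -> seq_perm S S' -> rule N ps S' ->
    (forall p, List.In p ps -> derivation N p) ->
    derivation N S.

Definition derivable (L : language) (label : eqType) (N : nlrule -> Prop)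
    (S : sequent L label) : Prop :=
  exists2 S', alpha_sequent S S' & derivation N S'.

(* Constant domains are required across all worlds, related or not: [NCons]
   puts the value of any variable in the domain of any world, so it is unsound
   when equality of domains is only required along [acc].  For instance it
   derives  w : exists x (x = x), which fails at a world with an empty domain
   and no accessibility links. *)
Definition frame_prop (r : nlrule) (F : frame) : Prop :=
  match r with
  | NRef => forall w : world F, acc w w
  | NSer => forall w : world F, exists v, acc w v
  | NTrans => forall w v u : world F, acc w v -> acc v u -> acc w u
  | NEucl => forall w v u : world F, acc w v -> acc w u -> acc v u
  | NIncr => forall w v : world F, acc w v -> forall o, dom w o -> dom v o
  | NDecr => forall w v : world F, acc w v -> forall o, dom v o -> dom w o
  | NCons => forall (w v : world F) o, dom w o <-> dom v o
  end.

Definition model_for (L : language) (N : nlrule -> Prop) (M : model L) : Prop :=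
  forall r, N r -> frame_prop r M.

(* The map f of labels to worlds and of variables to objects is the pair of
   [fl] and [f]. *)
Definition sx_sat (L : language) (label : eqType) (M : model L)
    (fl : label -> world M) (f : var L -> obj M) (e : sexpr L label) : Prop :=
  match e with
  | LF w A => sat f (fl w) A
  | Den (Var y) x w => f y = f x
  | Den (Iota y A) x w => forall o, sat (upd f y o) (fl w) A <-> o = f x
  end.

Definition ax_sat (L : language) (label : eqType) (M : model L)
    (fl : label -> world M) (f : var L -> obj M) (e : aexpr L label) : Prop :=
  match e with
  | Sx e' => sx_sat fl f e'
  | Dom x w => dom (fl w) (f x)
  | Rel w v => acc (fl w) (fl v)
  end.

Definition valid (L : language) (label : eqType) (N : nlrule -> Prop)
    (S : sequent L label) : Prop :=
  forall (M : model L), model_for N M ->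
  forall (fl : label -> world M) (f : var L -> obj M),
    (forall e, List.In e (ant S) -> ax_sat fl f e) ->
    exists2 e, List.In e (suc S) & sx_sat fl f e.

(* Main.v *)
Require Import Defs.
From mathcomp Require Import all_boot.
From Stdlib Require Import Classical.
From Stdlib Require List Permutation.

(** Soundness is proved contrapositively: a countermodel of the conclusion of a
    rule gives a countermodel of one of its premises, after reinterpreting the
    fresh label or variable.  Hence the conclusion of a derivation has no
    countermodel, and satisfaction is invariant under alphabetic variance.  The
    model has to change in one case only: seriality [Ser] allows the premise
    [Rel u u :: G ⇒ D] when [u] is fresh, and then an isolated reflexive world
    is added to interpret [u]. *)

Set Implicit Arguments.
Unset Strict Implicit.
Unset Printing Implicit Defensive.

(* Mutual induction principles and congruence of equivalences *)
Scheme term_mut := Induction for term Sort Prop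
  with formula_mut := Induction for formula Sort Prop.
Combined Scheme term_formula_ind from term_mut, formula_mut.

Scheme alpha_term_mut := Minimality for alpha_term Sort Prop
  with alpha_form_mut := Minimality for alpha_form Sort Prop.
Combined Scheme alpha_term_form_ind from alpha_term_mut, alpha_form_mut.

Lemma forall_in_iff (T : Type) (P Q R : T -> Prop) :
  (forall o, Q o <-> R o) ->
  (forall o, P o -> Q o) <-> (forall o, P o -> R o).
Proof. by move=> QR; split=> H o /H /QR. Qed.

Lemma ex2_iff (T : Type) (P P' Q Q' : T -> Prop) :
  (forall o, P o <-> P' o) -> (forall o, Q o <-> Q' o) ->
  (exists2 o, P o & Q o) <-> (exists2 o, P' o & Q' o).
Proof. by move=> PP QQ; split=> -[o /PP ? /QQ ?]; exists o. Qed.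

Lemma unique_iff (T : Type) (P Q : T -> Prop) :
  (forall o, P o <-> Q o) -> forall o, unique P o <-> unique Q o.
Proof. by move=> PQ o; split=> -[/PQ ? H]; split=> // o' /PQ /H. Qed.

Lemma eq_map_tuple (T1 T2 T : Type) n (f : T1 -> T) (g : T2 -> T)
    (xs : n.-tuple T1) (ys : n.-tuple T2) :
  (forall i, f (tnth xs i) = g (tnth ys i)) -> map_tuple f xs = map_tuple g ys.
Proof. by move=> fg; apply: eq_from_tnth => i; rewrite !tnth_map. Qed.

(** * Coincidence: dependence of satisfaction on the free variables only *)

Section Semantics.

Variables (L : language) (M : model L).

Implicit Types (f g : var L -> obj M) (w : world M) (o : obj M).

Lemma upd_same f x o : upd f x o x = o.
Proof. by rewrite /upd eqxx. Qed.

Lemma upd_neq f x o y : y != x -> upd f x o y = f y.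
Proof. by rewrite /upd => /negbTE ->. Qed.

(** The binder step: both assignments receive the same object at the bound variable, so agreement on
    the remaining variables suffices. *)
Lemma eq_upd (s : seq (var L)) f g x :
  {in [seq y <- s | y != x], f =1 g} ->
  forall o, {in s, upd f x o =1 upd g x o}.
Proof.
move=> fg o y ys; rewrite /upd; case: ifP => // /negbT yx.
by apply: fg; rewrite mem_filter yx.
Qed.

Lemma eq_den_sat :
  (forall t f g w, {in tfv t, f =1 g} ->
     forall o, den f w t o <-> den g w t o) /\
  (forall A f g w, {in fv A, f =1 g} -> sat f w A <-> sat g w A).
Proof.
have in_l (s1 s2 : seq (var L)) f g :
    {in s1 ++ s2, f =1 g} -> {in s1, f =1 g}.
  by move=> fg x xs; apply: fg; rewrite mem_cat xs.
have in_r (s1 s2 : seq (var L)) f g :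
    {in s1 ++ s2, f =1 g} -> {in s2, f =1 g}.
  by move=> fg x xs; apply: fg; rewrite mem_cat xs orbT.
apply: term_formula_ind => /=.
- by move=> x f g w fg o; rewrite fg // inE.
- move=> x A IH f g w fg; apply: unique_iff => o.
  exact/IH/eq_upd.
- move=> P xs f g w fg; rewrite (@eq_map_tuple _ _ _ _ f g xs xs) // => i.
  by apply: fg; rewrite mem_tnth.
- by move=> x y f g w fg; rewrite !fg // !inE eqxx ?orbT.
- by [].
- move=> A IHA B IHB f g w fg; have := IHA f g w (in_l _ _ _ _ fg).
  by have := IHB f g w (in_r _ _ _ _ fg); tauto.
- move=> A IHA B IHB f g w fg; have := IHA f g w (in_l _ _ _ _ fg).
  by have := IHB f g w (in_r _ _ _ _ fg); tauto.
- move=> A IHA B IHB f g w fg; have := IHA f g w (in_l _ _ _ _ fg).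
  by have := IHB f g w (in_r _ _ _ _ fg); tauto.
- by move=> x A IH f g w fg; apply: forall_in_iff => o; apply/IH/eq_upd.
- by move=> x A IH f g w fg; apply: ex2_iff => // o; apply/IH/eq_upd.
- by move=> A IH f g w fg; apply: forall_in_iff => v; apply: IH.
- by move=> A IH f g w fg; apply: ex2_iff => // v; apply: IH.
- move=> x A IHA t IHt f g w fg; apply: ex2_iff => o.
    exact/IHt/in_r/fg.
  exact/IHA/eq_upd/in_l/fg.
Qed.

Lemma eq_den t f g w o : {in tfv t, f =1 g} -> den f w t o <-> den g w t o.
Proof. by move=> fg; apply: eq_den_sat.1. Qed.

Lemma eq_sat A f g w : {in fv A, f =1 g} -> sat f w A <-> sat g w A.
Proof. exact: eq_den_sat.2. Qed.

(** * Substitution *)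

Lemma subst_notin_fv y x :
  (forall t : term L, x \notin tfv t -> tsubst y x t = t) /\
  (forall A : formula L, x \notin fv A -> subst y x A = A).
Proof.
have binder z (A : formula L) :
    (x \notin fv A -> subst y x A = A) ->
    x \notin [seq v <- fv A | v != z] ->
    (if z == x then A else subst y x A) = A.
  move=> IH; rewrite mem_filter negb_and negbK eq_sym.
  by case: ifP => //= _ /IH.
apply: term_formula_ind => /=.
- by move=> z; rewrite inE /vsubst eq_sym => /negbTE ->.
- by move=> z A IH /binder ->.
- move=> P zs zs_x; congr (Atom _); apply: eq_from_tnth => i.
  rewrite tnth_map /vsubst; case: eqP => // zx.
  by rewrite -zx mem_tnth in zs_x.
- move=> z1 z2; rewrite !inE negb_or /vsubst !(eq_sym x).
  by case/andP=> /negbTE -> /negbTE ->.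
- by [].
- by move=> A IHA B IHB; rewrite mem_cat negb_or => /andP[/IHA -> /IHB ->].
- by move=> A IHA B IHB; rewrite mem_cat negb_or => /andP[/IHA -> /IHB ->].
- by move=> A IHA B IHB; rewrite mem_cat negb_or => /andP[/IHA -> /IHB ->].
- by move=> z A IH /binder ->.
- by move=> z A IH /binder ->.
- by move=> A IH /IH ->.
- by move=> A IH /IH ->.
- move=> z A IHA t IHt; rewrite mem_cat negb_or.
  by case/andP=> /binder -> // /IHt ->.
Qed.

(** A fresh variable occurs next to no binder, so the rules with a fresh variable need no separate
    [free_for] condition. *)
Lemma free_for_notin_bv y x :
  (forall t : term L, y \notin tbv t -> tfree_for y x t) /\
  (forall A : formula L, y \notin bv A -> free_for y x A).
Proof.
have binder z (A : formula L) :
    (y \notin bv A -> free_for y x A) -> y \notin z :: bv A ->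
    [|| z == x, x \notin fv A | (z != y) && free_for y x A].
  by move=> IH; rewrite inE negb_or eq_sym => /andP[-> /IH ->]; rewrite !orbT.
apply: term_formula_ind => //=.
- by move=> A IHA B IHB; rewrite mem_cat negb_or => /andP[/IHA -> /IHB ->].
- by move=> A IHA B IHB; rewrite mem_cat negb_or => /andP[/IHA -> /IHB ->].
- by move=> A IHA B IHB; rewrite mem_cat negb_or => /andP[/IHA -> /IHB ->].
- move=> z A IHA t IHt; rewrite -cat_cons mem_cat negb_or.
  by case/andP=> /binder -> // /IHt ->.
Qed.

(** Two assignments linked by the renaming on the free variables are used, rather than [f] and
    [upd f x (f y)]: this link survives passage under a binder, and it covers both the instance at
    an existing variable and the instance at a fresh one. *)
Lemma den_sat_subst y x :
  (forall t f g w, tfree_for y x t ->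
     {in tfv t, forall v, g v = f (vsubst y x v)} ->
     forall o, den f w (tsubst y x t) o <-> den g w t o) /\
  (forall A f g w, free_for y x A ->
     {in fv A, forall v, g v = f (vsubst y x v)} ->
     sat f w (subst y x A) <-> sat g w A).
Proof.
have in_l (s1 s2 : seq (var L)) f g :
    {in s1 ++ s2, forall v, g v = f (vsubst y x v)} ->
    {in s1, forall v, g v = f (vsubst y x v)}.
  by move=> fg v vs; apply: fg; rewrite mem_cat vs.
have in_r (s1 s2 : seq (var L)) f g :
    {in s1 ++ s2, forall v, g v = f (vsubst y x v)} ->
    {in s2, forall v, g v = f (vsubst y x v)}.
  by move=> fg v vs; apply: fg; rewrite mem_cat vs orbT.
have binder z A f g w :
    (forall f g w, free_for y x A ->
       {in fv A, forall v, g v = f (vsubst y x v)} ->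
       sat f w (subst y x A) <-> sat g w A) ->
    [|| z == x, x \notin fv A | (z != y) && free_for y x A] ->
    {in [seq v <- fv A | v != z], forall v, g v = f (vsubst y x v)} ->
    forall o, sat (upd f z o) w (if z == x then A else subst y x A) <->
              sat (upd g z o) w A.
  move=> IH side fg o.
  (* If [z] is [x], or [x] is not free in [A], the body is unchanged, even when [z] is [y];
     coincidence then applies. *)
  have [xA | xA] := boolP ((z == x) || (x \notin fv A)).
    have -> : (if z == x then A else subst y x A) = A.
      by case: eqP xA => //= _; apply: (subst_notin_fv y x).2.
    apply: eq_sat => v vA; rewrite /upd; case: ifP => // /negbT vz.
    rewrite fg ?mem_filter ?vz // /vsubst; case: eqP => // vx; case/orP: xA.
      by rewrite -vx eq_sym (negbTE vz).
    by rewrite -vx vA.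
  (* Otherwise [free_for] forces [z] to differ from [y] as well, so updating at [z] commutes with
     the renaming. *)
  move: xA; rewrite negb_or negbK => /andP[zx xA].
  move: side; rewrite (negbTE zx) xA /= => /andP[zy fr].
  apply: IH => // v vA; have [-> | vz] := eqVneq v z.
    by rewrite /vsubst (negbTE zx) !upd_same.
  rewrite upd_neq // fg ?mem_filter ?vz // upd_neq // /vsubst.
  by case: ifP => // _; rewrite eq_sym.
apply: term_formula_ind => /=.
- by move=> z f g w _ fg o; rewrite fg // inE.
- by move=> z A IH f g w side fg; apply: unique_iff => o; apply: binder.
- move=> P zs f g w _ fg.
  rewrite (@eq_map_tuple _ _ _ _ f g _ zs) // => i.
  by rewrite tnth_map fg // mem_tnth.
- by move=> z1 z2 f g w _ fg; rewrite !fg // !inE eqxx ?orbT.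
- by [].
- move=> A IHA B IHB f g w /andP[frA frB] fg.
  have := IHA f g w frA (in_l _ _ _ _ fg).
  by have := IHB f g w frB (in_r _ _ _ _ fg); tauto.
- move=> A IHA B IHB f g w /andP[frA frB] fg.
  have := IHA f g w frA (in_l _ _ _ _ fg).
  by have := IHB f g w frB (in_r _ _ _ _ fg); tauto.
- move=> A IHA B IHB f g w /andP[frA frB] fg.
  have := IHA f g w frA (in_l _ _ _ _ fg).
  by have := IHB f g w frB (in_r _ _ _ _ fg); tauto.
- by move=> z A IH f g w side fg; apply: forall_in_iff => o; apply: binder.
- by move=> z A IH f g w side fg; apply: ex2_iff => // o; apply: binder.
- by move=> A IH f g w fr fg; apply: forall_in_iff => v; apply: IH.
- by move=> A IH f g w fr fg; apply: ex2_iff => // v; apply: IH.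
- move=> z A IHA t IHt f g w /andP[side fr] fg; apply: ex2_iff => o.
    by apply: IHt => //; apply/in_r/fg.
  by apply: binder => //; apply/in_l/fg.
Qed.

Lemma sat_subst y x A f w : free_for y x A ->
  sat f w (subst y x A) <-> sat (upd f x (f y)) w A.
Proof.
move=> fr; apply: (den_sat_subst y x).2 => // v _.
by rewrite /upd /vsubst; case: eqP.
Qed.

(** Transfers a witness [o] for a bound variable [x] to the fresh variable [z] of a premise. Both
    hypotheses follow from freshness of [z] for a formula or description binding [x] in [A]. *)
Lemma sat_subst_fresh z x A f w o :
  z \notin bv A -> z \notin [seq y <- fv A | y != x] ->
  sat (upd f z o) w (subst z x A) <-> sat (upd f x o) w A.
Proof.
move=> zb zf; apply: (den_sat_subst z x).2 => [|v vA].
  exact: (free_for_notin_bv z x).2.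
rewrite /vsubst; have [-> | vx] := eqVneq v x; first by rewrite !upd_same.
rewrite !upd_neq //; apply: contraNneq zf => <-.
by rewrite mem_filter vx.
Qed.

(** * Alphabetic variance *)

Lemma alpha_upd r x y f g :
  (forall u v, alpha_var r u v -> f u = g v) ->
  forall o u v, alpha_var ((x, y) :: r) u v -> upd f x o u = upd g y o v.
Proof.
move=> fg o u v /=; rewrite /upd.
by case: eqP => _; case: eqP => _ //=; apply: fg.
Qed.

(** Induction under binders requires an arbitrary list [r], with assignments that agree along the
    pairs it identifies. A new pair hides outer pairs just as the two updates override earlier
    values; for the empty list the condition is equality of the assignments. *)
Lemma alpha_den_sat :
  (forall r (t s : term L), alpha_term r t s ->
     forall f g w, (forall u v, alpha_var r u v -> f u = g v) ->
     forall o, den f w t o <-> den g w s o) /\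
  (forall r (A B : formula L), alpha_form r A B ->
     forall f g w, (forall u v, alpha_var r u v -> f u = g v) ->
     sat f w A <-> sat g w B).
Proof.
apply: alpha_term_form_ind => /=.
- by move=> r x y xy f g w fg o; rewrite (fg _ _ xy).
- move=> r x y A B _ IH f g w fg; apply: unique_iff => o.
  exact/IH/alpha_upd.
- move=> r P xs ys xys f g w fg.
  by rewrite (@eq_map_tuple _ _ _ _ f g xs ys) // => i; apply/fg/xys.
- by move=> r x1 x2 y1 y2 xy1 xy2 f g w fg; rewrite (fg _ _ xy1) (fg _ _ xy2).
- by [].
- move=> r A1 A2 B1 B2 _ IH1 _ IH2 f g w fg.
  by have := IH1 f g w fg; have := IH2 f g w fg; tauto.
- move=> r A1 A2 B1 B2 _ IH1 _ IH2 f g w fg.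
  by have := IH1 f g w fg; have := IH2 f g w fg; tauto.
- move=> r A1 A2 B1 B2 _ IH1 _ IH2 f g w fg.
  by have := IH1 f g w fg; have := IH2 f g w fg; tauto.
- move=> r x y A B _ IH f g w fg; apply: forall_in_iff => o.
  exact/IH/alpha_upd.
- move=> r x y A B _ IH f g w fg; apply: ex2_iff => // o.
  exact/IH/alpha_upd.
- by move=> r A B _ IH f g w fg; apply: forall_in_iff => v; apply: IH.
- by move=> r A B _ IH f g w fg; apply: ex2_iff => // v; apply: IH.
- move=> r x y A B t s _ IHA _ IHt f g w fg; apply: ex2_iff => o.
    exact: IHt.
  exact/IHA/alpha_upd.
Qed.

(** * Labelled sequents and their countermodels *)

Variable label : eqType.

Implicit Types (fl : label -> world M) (e : sexpr L label)
  (S : sequent L label).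

(** The biconditional clause for descriptions is unique satisfaction by [f x]. This permits a
    uniform treatment of denotation formulas for both kinds of term. *)
Lemma sx_sat_Den fl f t x (w : label) :
  sx_sat fl f (Den t x w) <-> den f (fl w) t (f x).
Proof.
case: t => [y | y A] /=; first by split=> ->.
rewrite /unique; split=> [H | [Ax Aun] o].
  by split=> [|o /H ->] //; apply/H.
by split=> [/Aun -> | ->].
Qed.

Lemma alpha_sx_sat fl f e e' :
  alpha_sx e e' -> sx_sat fl f e <-> sx_sat fl f e'.
Proof.
have id_env (u v : var L) : alpha_var [::] u v -> f u = f v.
  by move=> /= /eqP ->.
case=> [w A B AB | t s x w ts]; first exact: alpha_den_sat.2 AB _ _ _ id_env.
rewrite !sx_sat_Den; exact: alpha_den_sat.1 ts _ _ _ id_env _.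
Qed.

Lemma alpha_ax_sat fl f (a a' : aexpr L label) :
  alpha_ax a a' -> ax_sat fl f a <-> ax_sat fl f a'.
Proof. by case=> // e e'; apply: alpha_sx_sat. Qed.

Lemma eq_sx_sat fl fl' f f' e :
  {in sx_fv e, f =1 f'} -> {in sx_labels e, fl =1 fl'} ->
  sx_sat fl f e <-> sx_sat fl' f' e.
Proof.
case: e => [w A | t x w] ff ll.
  by rewrite /= ll ?inE //; apply: eq_sat.
rewrite !sx_sat_Den ll ?inE // ff ?inE ?eqxx //.
by apply: eq_den => v vt; apply: ff; rewrite inE vt orbT.
Qed.

Lemma eq_ax_sat fl fl' f f' (a : aexpr L label) :
  {in ax_fv a, f =1 f'} -> {in ax_labels a, fl =1 fl'} ->
  ax_sat fl f a <-> ax_sat fl' f' a.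
Proof.
case: a => [e | x w | w v] /= ff ll; first exact: eq_sx_sat.
  by rewrite ll ?ff ?inE.
by rewrite !ll ?inE ?eqxx ?orbT.
Qed.

Definition refutes fl f S : Prop :=
  List.Forall (ax_sat fl f) (ant S) /\
  List.Forall (fun e => ~ sx_sat fl f e) (suc S).

(** Basis for reinterpreting fresh symbols: a countermodel depends only on the values of the free
    variables and labels of the sequent. *)
Lemma refutes_eq fl fl' f f' S :
  {in seq_fv S, f =1 f'} -> {in seq_labels S, fl =1 fl'} ->
  refutes fl f S -> refutes fl' f' S.
Proof.
have sub (T : Type) (U : eqType) (F : T -> seq U) s a u :
    List.In a s -> u \in F a -> u \in flatten (map F s).
  elim: s => //= b s IH [-> | /IH H] uF; rewrite mem_cat ?uF //.
  by rewrite H ?orbT.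
move=> ff ll []; rewrite /refutes !List.Forall_forall => GS DS; split=> e eS.
  have := GS _ eS; rewrite (@eq_ax_sat fl fl' f f') // => u ue.
    by apply: ff; rewrite mem_cat (sub _ _ _ _ _ _ eS ue).
  by apply: ll; rewrite mem_cat (sub _ _ _ _ _ _ eS ue).
have := DS _ eS; rewrite (@eq_sx_sat fl fl' f f') // => u ue.
  by apply: ff; rewrite mem_cat (sub _ _ _ _ _ _ eS ue) orbT.
by apply: ll; rewrite mem_cat (sub _ _ _ _ _ _ eS ue) orbT.
Qed.

Lemma refutes_fresh_var fl f z o S :
  fresh_var z S -> refutes fl f S -> refutes fl (upd f z o) S.
Proof.
move=> /andP[zS _]; apply: refutes_eq => // v vS.
by rewrite upd_neq //; apply: contraNneq zS => <-.
Qed.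

Lemma fresh_var_ant z (a : aexpr L label) G D :
  fresh_var z (a :: G ⇒ D) -> (z \notin ax_fv a) && (z \notin ax_bv a).
Proof.
rewrite /fresh_var /seq_fv /seq_bv /= !mem_cat !negb_or -!andbA.
by case/and5P=> -> _ _ ->.
Qed.

Lemma fresh_var_suc z e G D :
  fresh_var z (G ⇒ e :: D) -> (z \notin sx_fv e) && (z \notin sx_bv e).
Proof.
rewrite /fresh_var /seq_fv /seq_bv /= !mem_cat !negb_or -!andbA.
by case/and5P=> _ -> _ _ /andP[-> _].
Qed.

Lemma fresh_label_ant u (a : aexpr L label) G D :
  fresh_label u (a :: G ⇒ D) -> u \notin ax_labels a.
Proof.
by rewrite /fresh_label /seq_labels /= !mem_cat !negb_or => /andP[/andP[]].
Qed.

Lemma fresh_label_suc u e G D :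
  fresh_label u (G ⇒ e :: D) -> u \notin sx_labels e.
Proof.
by rewrite /fresh_label /seq_labels /= !mem_cat !negb_or => /and3P[].
Qed.

Definition upd_label fl (u : label) (w : world M) : label -> world M :=
  fun v => if v == u then w else fl v.

Lemma upd_label_same fl u w : upd_label fl u w u = w.
Proof. by rewrite /upd_label eqxx. Qed.

Lemma upd_label_neq fl u w v : v != u -> upd_label fl u w v = fl v.
Proof. by rewrite /upd_label => /negbTE ->. Qed.

Lemma refutes_fresh_label fl f u w S :
  fresh_label u S -> refutes fl f S -> refutes (upd_label fl u w) f S.
Proof.
move=> uS; apply: refutes_eq => // v vS; rewrite /upd_label.
by case: eqP vS => // ->; rewrite (negbTE uS).
Qed.

Lemma refutes_ant fl f (a : aexpr L label) G D :
  refutes fl f (a :: G ⇒ D) <-> ax_sat fl f a /\ refutes fl f (G ⇒ D).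
Proof. by rewrite /refutes /= List.Forall_cons_iff; tauto. Qed.

Lemma refutes_suc fl f e G D :
  refutes fl f (G ⇒ e :: D) <-> ~ sx_sat fl f e /\ refutes fl f (G ⇒ D).
Proof. by rewrite /refutes /= List.Forall_cons_iff; tauto. Qed.

Lemma refutes_perm fl f S S' :
  seq_perm S S' -> refutes fl f S -> refutes fl f S'.
Proof.
move=> [pG pD] [G D]; split.
  exact: Permutation.Permutation_Forall pG G.
exact: Permutation.Permutation_Forall pD D.
Qed.

(** The classical passage from the absence of a countermodel to a true member of the succedent. *)
Lemma not_refutes_valid fl f S :
  ~ refutes fl f S -> List.Forall (ax_sat fl f) (ant S) ->
  exists2 e, List.In e (suc S) & sx_sat fl f e.
Proof.
move=> nS GS; apply: NNPP => nD; apply: nS; split=> //.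
by apply/List.Forall_forall => e eD e_sat; apply: nD; exists e.
Qed.

Lemma atomic_free_for y x (p : formula L) : atomic p -> free_for y x p.
Proof. by case: p. Qed.

(** Expressions allowed by [repl_expr] contain no binder, so no capture occurs and both instances
    are evaluated at the same objects. *)
Lemma repl_sat fl f (w : label) E x y z :
  repl_expr w E -> f y = f z ->
  ax_sat fl f (ax_subst y x E) -> ax_sat fl f (ax_subst z x E).
Proof.
move=> wE yz; have fyz v : f (vsubst y x v) = f (vsubst z x v).
  by rewrite /vsubst; case: eqP.
case: wE => [x1 x2 | x1 | p pat] /=; rewrite -?fyz //.
by rewrite !sat_subst ?atomic_free_for // yz.
Qed.

Lemma alpha_refutes fl f S S' :
  alpha_sequent S S' -> refutes fl f S -> refutes fl f S'.
Proof.
have transfer (T : Type) (R : T -> T -> Prop) (P : T -> Prop) :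
    (forall a b, R a b -> P a <-> P b) ->
    forall s s', List.Forall2 R s s' -> List.Forall P s -> List.Forall P s'.
  move=> RP s s'; elim=> // a b {}s {}s' /RP ab _ IH.
  by rewrite !List.Forall_cons_iff => -[/ab ? /IH].
move=> [aG aD] [HG HD]; split.
  by apply: transfer aG HG => a b; apply: alpha_ax_sat.
by apply: transfer aD HD => a b ab; rewrite (alpha_sx_sat _ _ ab).
Qed.

End Semantics.

(** * Adding an isolated reflexive world *)

Section AddLoop.

Variables (L : language) (M : model L) (w0 : world M).

(** The new world [None] sees itself and is otherwise unrelated: old worlds keep their
    successors. *)
Definition add_loop_acc (w v : option (world M)) : Prop :=
  match w, v with
  | Some w', Some v' => acc w' v'
  | None, None => True
  | _, _ => False
  end.

(* A copy of the domain of [w0] at the new world keeps constant domains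
   constant. *)
Definition add_loop_dom (w : option (world M)) : obj M -> Prop :=
  dom (if w is Some w' then w' else w0).

Lemma add_loop_dom_cover (o : obj M) : exists w, add_loop_dom w o.
Proof. by have [w wo] := dom_cover o; exists (Some w). Qed.

Definition add_loop_frame : frame :=
  @Frame (option (world M)) add_loop_acc (obj M) add_loop_dom
    (inhabits None) (obj_inh M) add_loop_dom_cover.

Definition add_loop : model L :=
  @Model L add_loop_frame
    (fun P w => if w is Some w' then interp (m := M) (P := P) w'
                else fun _ => False).

(** Conditions along accessibility split: mixed cases are vacuous, and at [None] the loop satisfies
    each of them. Constant domains hold because [None] copies an old domain. *)
Lemma add_loop_model_for (N : nlrule -> Prop) :
  model_for N M -> model_for N add_loop.
Proof.
move=> MN r /MN; case: r => /= H.
- by case=> [w|] //=; apply: H.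
- case=> [w|]; last by exists None.
  by have [v wv] := H w; exists (Some v).
- by case=> [w|] [v|] [u|] //=; apply: H.
- by case=> [w|] [v|] [u|] //=; apply: H.
- by case=> [w|] [v|] //=; apply: H.
- by case=> [w|] [v|] //=; apply: H.
- by move=> w v o; apply: H.
Qed.

(** Modalities at an old world inspect only old worlds, and the objects are unchanged, so uniqueness
    in descriptions ranges over the same set. *)
Lemma add_loop_den_sat :
  (forall (t : term L) (f : var L -> obj M) (w : world M) (o : obj M),
     den (M := add_loop) f (Some w) t o <-> den f w t o) /\
  (forall (A : formula L) (f : var L -> obj M) (w : world M),
     sat (M := add_loop) f (Some w) A <-> sat f w A).
Proof.
apply: term_formula_ind => //=.
- by move=> x A IH f w; apply: unique_iff => o; apply: IH.
- by move=> A IHA B IHB f w; rewrite IHA IHB.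
- by move=> A IHA B IHB f w; rewrite IHA IHB.
- by move=> A IHA B IHB f w; rewrite IHA IHB.
- by move=> x A IH f w; apply: forall_in_iff => o; apply: IH.
- by move=> x A IH f w; apply: ex2_iff => // o; apply: IH.
- move=> A IH f w; split=> H; first by move=> v wv; apply/IH/H.
  by case=> [v|] //= wv; apply/IH/H.
- move=> A IH f w; split; last by case=> v wv /IH; exists (Some v).
  by case=> -[v|] //= wv /IH; exists v.
- move=> x A IHA t IHt f w; apply: ex2_iff => o; first exact: IHt.
  exact: IHA.
Qed.

Lemma refutes_add_loop (label : eqType) (fl : label -> world M)
    (f : var L -> obj M) (S : sequent L label) :
  refutes fl f S ->
  refutes (M := add_loop) (fun v => Some (fl v)) f S.
Proof.
have sxE (e : sexpr L label) :
    sx_sat (M := add_loop) (fun v => Some (fl v)) f e <-> sx_sat fl f e.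
  case: e => [w A | t x w]; first exact: add_loop_den_sat.2.
  by rewrite !sx_sat_Den; apply: add_loop_den_sat.1.
case=> G D; split.
  by apply: List.Forall_impl G => -[e /sxE | |].
by apply: List.Forall_impl D => e; rewrite sxE.
Qed.

End AddLoop.

(** * Preservation of countermodels by the rules, and soundness *)

Definition refutable (L : language) (label : eqType) (N : nlrule -> Prop)
    (S : sequent L label) : Prop :=
  exists (M : model L) (fl : label -> world M) (f : var L -> obj M),
    model_for N M /\ refutes fl f S.

(** The conclusion asks for [refutable] premises rather than refutation in [M] itself, which leaves
    room for the enlarged model in the case of [Ser]. *)
Lemma refutes_rule (L : language) (label : eqType) (N : nlrule -> Prop)
    (M : model L) ps (S : sequent L label) :
  model_for N M -> rule N ps S ->
  forall (fl : label -> world M) (f : var L -> obj M), refutes fl f S ->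
  List.Exists (refutable N) ps.
Proof.
move=> MN; have same_model (fl : label -> world M) f S' :
    refutes fl f S' -> refutable N S'.
  by exists M, fl, f.
case=> {ps S}.
- by move=> w p G D _ fl f; rewrite refutes_ant refutes_suc /=; tauto.
- by move=> y x w G D fl f; rewrite refutes_ant refutes_suc /=; tauto.
- by move=> w G D fl f; rewrite refutes_ant /=; tauto.
- move=> w A B G D fl f; rewrite refutes_ant /= => H.
  by left; apply: (same_model fl f); rewrite !refutes_ant /=; tauto.
- move=> w A B G D fl f; rewrite refutes_suc /= => H.
  (* Excluded middle selects the premise whose conjunct fails. *)
  have [HA | HA] := classic (sat f (fl w) A).
    by right; left; apply: (same_model fl f); rewrite refutes_suc /=; tauto.
  by left; apply: (same_model fl f); rewrite refutes_suc /=; tauto.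
- move=> w A B G D fl f; rewrite refutes_ant /= => -[[HA | HB] H].
    by left; apply: (same_model fl f); rewrite refutes_ant /=; tauto.
  by right; left; apply: (same_model fl f); rewrite refutes_ant /=; tauto.
- move=> w A B G D fl f; rewrite refutes_suc /= => H.
  by left; apply: (same_model fl f); rewrite !refutes_suc /=; tauto.
- move=> w A B G D fl f; rewrite refutes_ant /= => H.
  have [HA | HA] := classic (sat f (fl w) A).
    by right; left; apply: (same_model fl f); rewrite refutes_ant /=; tauto.
  by left; apply: (same_model fl f); rewrite refutes_suc /=; tauto.
- move=> w A B G D fl f; rewrite refutes_suc /= => H.
  by left; apply: (same_model fl f); rewrite refutes_ant refutes_suc /=; tauto.
- move=> w x y A G D fr fl f H; left; apply: (same_model fl f).
  rewrite refutes_ant /= sat_subst //; split=> //.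
  by move: H; rewrite !refutes_ant /= => -[Dy [HA _]]; apply: HA.
- move=> w x z A G D fz fl f H.
  (* An object of the domain at which [A] fails becomes the value of [z]. *)
  have [/not_all_ex_not[o Ho] _] := (refutes_suc _ _ _ _ _).1 H.
  have [wo nA] := imply_to_and _ _ Ho.
  have [_ HGD] := (refutes_suc _ _ _ _ _).1 (refutes_fresh_var o fz H).
  have /= := fresh_var_suc fz; rewrite inE negb_or => /and3P[zf _ zb].
  left; apply: (same_model fl (upd f z o)).
  rewrite refutes_ant refutes_suc /=.
  by rewrite upd_same sat_subst_fresh.
- move=> w x z A G D fz fl f H.
  have [[o wo Ho] _] := (refutes_ant _ _ _ _ _).1 H.
  have [_ HGD] := (refutes_ant _ _ _ _ _).1 (refutes_fresh_var o fz H).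
  have /= := fresh_var_ant fz; rewrite inE negb_or => /and3P[zf _ zb].
  left; apply: (same_model fl (upd f z o)); rewrite !refutes_ant /=.
  by rewrite upd_same sat_subst_fresh.
- move=> w x y A G D fr fl f H; left; apply: (same_model fl f); move: H.
  rewrite !(refutes_ant, refutes_suc) /= sat_subst // => -[Dy [nA H]].
  by do !split=> //; apply: contra_not nA => Ay; exists (f y).
- move=> w v A G D fl f H; left; apply: (same_model fl f); move: H.
  rewrite !refutes_ant /= => -[wv [HA H]]; do !split=> //.
  exact: HA.
- move=> w u A G D fu fl f H.
  (* An accessible world at which [A] fails interprets the fresh label [u]. *)
  have [/not_all_ex_not[v Hv] _] := (refutes_suc _ _ _ _ _).1 H.
  have [wv nA] := imply_to_and _ _ Hv.
  have [_ HGD] := (refutes_suc _ _ _ _ _).1 (refutes_fresh_label v fu H).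
  left; apply: (same_model (upd_label fl u v) f).
  rewrite refutes_ant refutes_suc /=.
  by rewrite upd_label_same upd_label_neq //
    eq_sym -mem_seq1 (fresh_label_suc fu).
- move=> w u A G D fu fl f H.
  have [[v wv Hv] _] := (refutes_ant _ _ _ _ _).1 H.
  have [_ HGD] := (refutes_ant _ _ _ _ _).1 (refutes_fresh_label v fu H).
  left; apply: (same_model (upd_label fl u v) f); rewrite !refutes_ant /=.
  by rewrite upd_label_same upd_label_neq //
    eq_sym -mem_seq1 (fresh_label_ant fu).
- move=> w v A G D fl f H; left; apply: (same_model fl f); move: H.
  rewrite !(refutes_ant, refutes_suc) /= => -[wv [nA H]].
  by do !split=> //; apply: contra_not nA => Av; exists (fl v).
- move=> w x G D fl f H; left; apply: (same_model fl f).
  by rewrite refutes_ant.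
(* Identity is evaluated independently of the world. *)
- move=> v w y z G D fl f H; left; apply: (same_model fl f); move: H.
  by rewrite !refutes_ant /=; tauto.
- move=> w x y z E G D wE fl f H; left; apply: (same_model fl f).
  rewrite refutes_ant; split=> //.
  move: H; rewrite !refutes_ant /= => -[Ey [yz _]].
  exact: repl_sat wE yz Ey.
- move=> w x z B t G D fz fl f H.
  (* The denotation [o] of [t] is the value for [z]; as [z] is not free in [t], the update leaves
     this denotation unchanged. *)
  have [[o to Ho] _] := (refutes_ant _ _ _ _ _).1 H.
  have [_ HGD] := (refutes_ant _ _ _ _ _).1 (refutes_fresh_var o fz H).
  have /= := fresh_var_ant fz; rewrite inE !mem_cat !negb_or.
  case/and3P=> /andP[zf zt] _ /andP[zb _].
  left; apply: (same_model fl (upd f z o)); rewrite !refutes_ant.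
  split; last by rewrite /= sat_subst_fresh.
  apply/sx_sat_Den; rewrite upd_same.
  rewrite (eq_den (g := f)) // => v vt; rewrite upd_neq //.
  by apply: contraNneq zt => <-.
- move=> w x y B t G D fr fl f H.
  (* If [t] denotes the value of [y], then [B] must fail there, since otherwise the abstract would
     hold. *)
  have [tl | ntl] := classic (sx_sat fl f (Den t y w)); last first.
    left; apply: (same_model fl f); move: H; rewrite !refutes_suc; tauto.
  right; left; apply: (same_model fl f); move: H; rewrite !refutes_suc.
  move=> [nL H]; do !split=> //; apply: contra_not nL.
  rewrite /= sat_subst // => By; exists (f y) => //.
  exact/sx_sat_Den.
- move=> w x1 x2 A G D fr fl f H; left; apply: (same_model fl f).
  rewrite refutes_ant; split=> //; move: H.
  by rewrite refutes_ant /= sat_subst // => -[-> _].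
- move=> w x1 x2 y A G D fr fl f H.
  have [DA _] := (refutes_ant _ _ _ _ _).1 H.
  (* If [y] satisfies the description, uniqueness identifies it with [x2]. *)
  have [yA | yA] := classic (sat f (fl w) (subst y x1 A)).
    right; left; apply: (same_model fl f); rewrite refutes_ant; split=> //=.
    by apply/esym/DA; rewrite -sat_subst.
  by left; apply: (same_model fl f); rewrite refutes_suc.
- move=> w x1 x2 z A G D fr fz fl f H.
  have [nD HGD] := (refutes_suc _ _ _ _ _).1 H.
  have [A2 | A2] := classic (sat f (fl w) (subst x2 x1 A)); last first.
    by left; apply: (same_model fl f); rewrite refutes_suc.
  rewrite sat_subst // in A2.
  (* As [x2] satisfies [A], denotation can fail only through a second object satisfying [A]; that
     object interprets [z]. *)
  have [o Ao ne] : exists2 o, sat (upd f x1 o) (fl w) A & o <> f x2.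
    apply: NNPP => no; apply: nD => o; split=> [Ao | -> //].
    by apply: NNPP => ne; apply: no; exists o.
  have [_ {}HGD] := (refutes_suc _ _ _ _ _).1 (refutes_fresh_var o fz H).
  have /= := fresh_var_suc fz; rewrite !inE !negb_or.
  case/and3P=> /andP[zx2 zf] _ zb.
  right; left; apply: (same_model fl (upd f z o)).
  rewrite refutes_ant refutes_suc /=.
  rewrite sat_subst_fresh // upd_same upd_neq 1?eq_sym //.
  by do !split=> //; apply: nesym.
- move=> w x G D fl f H; left; apply: (same_model fl f).
  by rewrite refutes_ant.
- move=> w x y G D fl f H; left; apply: (same_model fl f).
  rewrite refutes_ant; split=> //.
  by move: H; rewrite refutes_ant => -[].
- move=> w G D NR fl f H; left; apply: (same_model fl f).
  by rewrite refutes_ant; split=> //; apply: (MN _ NR).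
- move=> w u G D NS fu fl f H.
  (* For [w] equal to [u] a reflexive world is required, which seriality alone does not supply;
     otherwise a successor of [fl w] interprets [u]. *)
  have [wu | wu] := eqVneq w u.
    left; exists (add_loop (fl w)), (upd_label (M := add_loop (fl w))
      (fun v => Some (fl v)) u None), f.
    split; first exact: add_loop_model_for.
    rewrite refutes_ant /= wu !upd_label_same; split=> //.
    exact/refutes_fresh_label/refutes_add_loop.
  have [v wv] := MN _ NS (fl w).
  left; apply: (same_model (upd_label fl u v) f).
  rewrite refutes_ant /= upd_label_same upd_label_neq //.
  by split=> //; apply: refutes_fresh_label.
- move=> w v u G D NT fl f H; left; apply: (same_model fl f).
  rewrite refutes_ant; split=> //; move: H.
  rewrite !refutes_ant /= => -[wv [vu _]].
  exact: (MN _ NT) wv vu.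
- move=> w v u G D NE fl f H; left; apply: (same_model fl f).
  rewrite refutes_ant; split=> //; move: H.
  rewrite !refutes_ant /= => -[wv [wu _]].
  exact: (MN _ NE) wv wu.
- move=> w v G D NE fl f H; left; apply: (same_model fl f).
  rewrite refutes_ant; split=> //; move: H.
  rewrite refutes_ant /= => -[wv _].
  (* Euclideanness with both successors taken to be the same world. *)
  exact: (MN _ NE _ _ _ wv wv).
- move=> w v x G D NI fl f H; left; apply: (same_model fl f).
  rewrite refutes_ant; split=> //; move: H.
  rewrite !refutes_ant /= => -[xw [wv _]].
  exact: (MN _ NI) wv _ xw.
- move=> w v x G D ND fl f H; left; apply: (same_model fl f).
  rewrite refutes_ant; split=> //; move: H.
  rewrite !refutes_ant /= => -[xv [wv _]].
  exact: (MN _ ND) wv _ xv.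
- move=> w x G D NC fl f H; left; apply: (same_model fl f).
  (* Every object lies in some domain, and constancy moves it to the domain of [fl w]. *)
  rewrite refutes_ant; split=> //=; have [v vx] := dom_cover (f x).
  exact/(MN _ NC v).
Qed.

(** A countermodel of the conclusion would pass to a premise, against the induction hypothesis; an
    initial sequent has no premise to receive it. *)
Lemma derivation_irrefutable (L : language) (label : eqType)
    (N : nlrule -> Prop) (S : sequent L label) :
  derivation N S -> ~ refutable N S.
Proof.
elim=> {}S S' ps _ SS' r _ IH [M [fl [f [MN]]]].
move=> /(refutes_perm SS') /(refutes_rule MN r) /List.Exists_exists.
by case=> p [/IH].
Qed.

Theorem mainTheorem1 (L : language) (label : eqType) (N : nlrule -> Prop)
    (S : sequent L label) :
  derivable N S -> valid N S.
Proof.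
case=> S' SS' dS' M MN fl f HG; apply: not_refutes_valid.
  (* Only an alphabetic variant need have a derivation, so the countermodel is first carried over to
     it. *)
  move=> /(alpha_refutes SS') refS'.
  by apply: (derivation_irrefutable dS'); exists M, fl, f.
exact/List.Forall_forall.
Qed.
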